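(* The arithmetic inverse monoid $\mathcal A$ (the inverse subsemigroup of $\mathcal I(\mathbb N)$ generated by $\{R_{a,b}:a>b\in\mathbb N\}$) contains: (1) an isomorphic copy of Leech's multiplicative monoid $\mathcal L$, generated (as an inverse monoid) by $\{R_{a,0}:a\in\mathbb N^+\}$; (2) for all $a>1$, an isomorphic copy of the polycyclic monoid $\mathcal P_a$, generated (as an inverse monoid) by $\{R_{a,b}: b<a,\ b\in\mathbb N\}$; (3) countably infinitely many distinct isomorphic copies of the bicyclic monoid $\mathcal B$.
   Context: $\mathbb N=\{0,1,2,\dots\}$, $\mathbb N^+=\mathbb N\setminus\{0\}$. $\mathcal I(\mathbb N)$ is the symmetric inverse monoid on $\mathbb N$: all partial injections $\mathbb N\to\mathbb N$ under composition of partial functions ($fg$ means first $g$, then $f$), with generalised inverse $f^\ddagger(y)=x$ iff $f(x)=y$. For $a>b\in\mathbb N$, $R_{a,b}\in\mathcal I(\mathbb N)$ is the partial injection with domain $\{an+b:n\in\mathbb N\}$ given by $R_{a,b}(n)=\frac{n-b}{a}$. Leech's monoid $\mathcal L$ is the inverse monoid with underlying set $\mathbb N^+\times\mathbb N^+$, composition $(m,n)(p,q)=\left(\frac{mp}{\gcd(n,p)},\frac{nq}{\gcd(n,p)}\right)$ and generalised inverse $(m,n)^\ddagger=(n,m)$. For $k>1$, $\mathcal P_k$ is the inverse monoid with zero $\epsilon$ generated by $\{0,\dots,k-1\}$ subject to $xy^\ddagger=Id$ if $x=y$ and $xy^\ddagger=\epsilon$ if $x\neq y$. The bicyclic monoid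 $\mathcal B$ is the inverse monoid with one generator $s$ and the single relation $s^\ddagger s=Id$; equivalently $\mathbb N\times\mathbb N$ with $(d,c)(b,a)=(d+\max(b-c,0),\max(c-b,0)+a)$. *)

(* Defs.v *)
From HB Require Import structures.
From mathcomp Require Import all_boot.
From mathcomp Require Import boolp classical_sets functions cardinality.
From mathcomp Require Import zify.

Set Implicit Arguments.
Unset Strict Implicit.
Unset Printing Implicit Defensive.

Import Algebra.

Local Open Scope group_scope.

(* An inverse monoid is a monoid with an involutive antiautomorphism [x^-1]
   (the generalised inverse) such that [x * x^-1 * x = x] and the idempotents
   [x * x^-1] commute; [x^-1] is then the unique generalised inverse of [x]. *)
HB.mixin Record StarMonoid_isInverseMonoid M of StarMonoid M := {
  mulgVg : forall x : M, x * x^-1 * x = x;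
  mulgV_comm : forall x y : M,
    (x * x^-1) * (y * y^-1) = (y * y^-1) * (x * x^-1)
}.

#[short(type="inverseMonoidType")]
HB.structure Definition InverseMonoid :=
  { M of StarMonoid_isInverseMonoid M & StarMonoid M }.

Definition inverse_subsemigroup (M : inverseMonoidType) (S : set M) : Prop :=
  (forall x y, S x -> S y -> S (x * y)) /\ (forall x, S x -> S x^-1).

Definition inverse_submonoid (M : inverseMonoidType) (S : set M) : Prop :=
  S 1 /\ inverse_subsemigroup S.

Definition inverse_semigroup_gen (M : inverseMonoidType) (G : set M) : set M :=
  smallest (@inverse_subsemigroup M) G.

Definition inverse_monoid_gen (M : inverseMonoidType) (G : set M) : set M :=
  smallest (@inverse_submonoid M) G.

(* [S] is an inverse submonoid of [N] isomorphic to [M]. *)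
Definition isomorphic_copy (M N : inverseMonoidType) (S : set N) : Prop :=
  exists f : M -> N,
    [/\ monoid_morphism f, {morph f : x / x^-1}, injective f & range f = S].

Section PartialInjections.
Variable T : Type.

Definition partial_injective (f : T -> option T) : Prop :=
  forall x y z, f x = Some z -> f y = Some z -> x = y.

Record pinj := PInj {
  pinj_fun :> T -> option T;
  pinj_inj : partial_injective pinj_fun }.

HB.instance Definition _ := gen_eqMixin pinj.
HB.instance Definition _ := gen_choiceMixin pinj.

Lemma pinjP (f g : pinj) :
  (forall x y, f x = Some y <-> g x = Some y) -> f = g.
Proof.
case: f g => [f fi] [g gi] /= fg.
have E : f = g.
  apply/funext => x; case Ef: (f x) => [y|]; first by symmetry; apply/fg.
  by case Eg: (g x) => [y|] //; move/fg: Eg; rewrite Ef.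
by case: _ / E in gi fg *; congr PInj; exact: Prop_irrelevance.
Qed.

Definition pinj_one : pinj.
Proof. by exists (@Some T) => x y z [->] [->]. Defined.

Lemma pcomp_inj (f g : pinj) : partial_injective (pcomp f g).
Proof.
rewrite /pcomp => x y z; case Ex: (g x) => [u|] //=; case Ey: (g y) => [v|] //=.
by move=> Eu Ev; apply: (pinj_inj Ex); rewrite Ey (pinj_inj Eu Ev).
Qed.

Definition pinj_mul (f g : pinj) : pinj := PInj (@pcomp_inj f g).

Definition pinj_inv_fun (f : pinj) (y : T) : option T :=
  if pselect (exists x, f x = Some y) is left xP then Some (projT1 (cid xP))
  else None.

Lemma pinj_inv_funE (f : pinj) x y :
  pinj_inv_fun f y = Some x <-> f x = Some y.
Proof.
rewrite /pinj_inv_fun; case: pselect => [xP|nxP].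
  case: cid => u /= fu; split=> [[<-] //|fx].
  by rewrite (pinj_inj fu fx).
by split=> // fx; case: nxP; exists x.
Qed.

Lemma pinj_inv_inj (f : pinj) : partial_injective (pinj_inv_fun f).
Proof.
by move=> x y z /pinj_inv_funE fx /pinj_inv_funE; rewrite fx => -[].
Qed.

Definition pinj_inv (f : pinj) : pinj := PInj (@pinj_inv_inj f).

Lemma pinj_mulE (f g : pinj) x y :
  pinj_mul f g x = Some y <-> exists2 z, g x = Some z & f z = Some y.
Proof.
rewrite /= /pcomp; split; last by case=> z -> /=.
by case: (g x) => [z|] //= fz; exists z.
Qed.

Lemma pinj_mulA : associative pinj_mul.
Proof.
by move=> f g h; apply: pinjP => x y; rewrite /= /pcomp; case: (h x).
Qed.

Lemma pinj_mul1 : left_id pinj_one pinj_mul.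
Proof. by move=> f; apply: pinjP => x y; rewrite /= /pcomp; case: (f x). Qed.

Lemma pinj_invK : involutive pinj_inv.
Proof.
by move=> f; apply: pinjP => x y; rewrite !pinj_inv_funE.
Qed.

Lemma pinj_invM : {morph pinj_inv : f g / pinj_mul f g >-> pinj_mul g f}.
Proof.
move=> f g; apply: pinjP => x y; rewrite pinj_inv_funE !pinj_mulE.
by split=> -[z]; exists z; apply/pinj_inv_funE.
Qed.

HB.instance Definition _ := isStarMonoid.Build pinj
  pinj_mulA pinj_mul1 pinj_invK pinj_invM.

Lemma pinj_mulgVE (f : pinj) x y :
  (f * f^-1) x = Some y <-> x = y /\ exists z, f z = Some x.
Proof.
split=> [/pinj_mulE[z /pinj_inv_funE fz]|[<- [z fz]]].
  by rewrite fz => -[<-]; split=> //; exists z.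
by apply/pinj_mulE; exists z => //; apply/pinj_inv_funE.
Qed.

Lemma pinj_mulgVg (f : pinj) : f * f^-1 * f = f.
Proof.
apply: pinjP => x y; rewrite pinj_mulE; split=> [[z fx /pinj_mulgVE[<-]] //|fx].
by exists y => //; apply/pinj_mulgVE; split=> //; exists x.
Qed.

Lemma pinj_mulgV_comm (f g : pinj) :
  (f * f^-1) * (g * g^-1) = (g * g^-1) * (f * f^-1).
Proof.
apply: pinjP => x y; rewrite !pinj_mulE.
by split=> -[z /pinj_mulgVE[<- Hx] /pinj_mulgVE[<- Hx']];
  exists x; apply/pinj_mulgVE.
Qed.

HB.instance Definition _ := StarMonoid_isInverseMonoid.Build pinj
  pinj_mulgVg pinj_mulgV_comm.

End PartialInjections.

Definition arith_fun (a b n : nat) : option nat :=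
  if `[< exists m, n = (a * m + b)%N >] then Some ((n - b) %/ a)%N else None.

Lemma arith_fun_inj a b : partial_injective (arith_fun a b).
Proof.
move=> x y z; rewrite /arith_fun.
case: asboolP => // -[m ->]; case: asboolP => // -[k ->].
rewrite !addnK; case: a => [|a] //.
by rewrite !mulKn // => -[->] [->].
Qed.

(* Meaningful for [b < a] only; every use below carries this condition. *)
Definition arith (a b : nat) : pinj nat := PInj (@arith_fun_inj a b).

Definition arithmetic_monoid : set (pinj nat) :=
  inverse_semigroup_gen [set f | exists a b, (b < a)%N /\ f = arith a b].

Definition posnat := {n : nat | (0 < n)%N}.

Definition leech := (posnat * posnat)%type.

Section Leech.
Implicit Types u v w : leech.

Lemma leech_mul_proof (m n p : posnat) :
  (0 < val m * val p %/ gcdn (val n) (val p))%N.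
Proof.
have m0 := valP m; have n0 := valP n; have p0 := valP p.
rewrite divn_gt0 ?gcdn_gt0 ?n0 //.
apply: (@leq_trans (val p)); last by rewrite leq_pmull.
by apply: dvdn_leq => //; exact: dvdn_gcdr.
Qed.

Lemma leech_mul_proof' (n p q : posnat) :
  (0 < val n * val q %/ gcdn (val n) (val p))%N.
Proof. by rewrite mulnC gcdnC; exact: leech_mul_proof. Qed.

Definition leech_mul u v : leech :=
  let: ((m, n), (p, q)) := (u, v) in
  (exist _ (val m * val p %/ gcdn (val n) (val p))%N (leech_mul_proof m n p),
   exist _ (val n * val q %/ gcdn (val n) (val p))%N (leech_mul_proof' n p q)).

Definition leech_one : leech :=
  let one : posnat := exist _ 1%N isT in (one, one).

Definition leech_inv u : leech := (u.2, u.1).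

(* The axioms of an inverse monoid are transported along the embedding that
   sends [(m, n)] to the partial injection [n * k |-> m * k]. *)
Definition leech_act_fun u (x : nat) : option nat :=
  if (val u.2 %| x)%N then Some (val u.1 * (x %/ val u.2))%N else None.

Lemma leech_act_funE u x y :
  leech_act_fun u x = Some y <->
  exists k, x = (val u.2 * k)%N /\ y = (val u.1 * k)%N.
Proof.
rewrite /leech_act_fun; split.
  case: ifP => // /dvdnP[k ->] [<-]; exists k.
  by rewrite mulnK ?(valP u.2) // mulnC.
by move=> [k [-> ->]]; rewrite dvdn_mulr // mulKn ?(valP u.2).
Qed.

Lemma leech_act_inj u : partial_injective (leech_act_fun u).
Proof.
move=> x y z /leech_act_funE[k [-> ->]] /leech_act_funE[l [-> /eqP]].
by rewrite eqn_pmul2l ?(valP u.1) // => /eqP->.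
Qed.

Definition leech_act u : pinj nat := PInj (@leech_act_inj u).

Lemma leech_actI : injective leech_act.
Proof.
move=> [m n] [p q] E.
have Ef x y : leech_act_fun (m, n) x = Some y <->
              leech_act_fun (p, q) x = Some y.
  by have := congr1 (fun f : pinj nat => f x) E; rewrite /= => ->.
have /Ef/leech_act_funE /= [k [Enk Emk]] :
    leech_act_fun (m, n) (val n) = Some (val m).
  by apply/leech_act_funE; exists 1%N; rewrite !muln1.
have /Ef/leech_act_funE /= [l [Eql Epl]] :
    leech_act_fun (p, q) (val q) = Some (val p).
  by apply/leech_act_funE; exists 1%N; rewrite !muln1.
have lk1 : (l * k)%N = 1%N.
  apply/eqP; rewrite -(eqn_pmul2l (valP n)) mulnA muln1.
  by rewrite -Eql -Enk.
have k1 : k = 1%N by apply/eqP; rewrite -dvdn1 -lk1 dvdn_mull.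
by congr pair; apply: val_inj; rewrite /= ?Enk ?Emk k1 muln1.
Qed.

Lemma leech_act1 : leech_act leech_one = 1.
Proof.
apply: pinjP => x y; split=> [/leech_act_funE[k /= [-> ->]]|[<-]].
  by rewrite !mul1n.
by apply/leech_act_funE; exists x; rewrite !mul1n.
Qed.

Lemma leech_actV : {morph leech_act : u / leech_inv u >-> u^-1}.
Proof.
move=> u; apply: pinjP => x y; rewrite [X in _ <-> X]pinj_inv_funE.
by rewrite !leech_act_funE; split=> -[k [-> ->]]; exists k.
Qed.

Lemma leech_comp (m n p q x y : nat) : (0 < n)%N -> (0 < p)%N ->
  (exists k, x = (n * q %/ gcdn n p * k)%N /\
             y = (m * p %/ gcdn n p * k)%N) <->
  exists2 z, (exists k, x = (q * k)%N /\ z = (p * k)%N)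
           & (exists k, z = (n * k)%N /\ y = (m * k)%N).
Proof.
move=> n0 p0; set g := gcdn n p.
have g0 : (0 < g)%N by rewrite gcdn_gt0 n0.
have [n' En] : exists n', n = (n' * g)%N by apply/dvdnP; exact: dvdn_gcdl.
have [p' Ep] : exists p', p = (p' * g)%N by apply/dvdnP; exact: dvdn_gcdr.
have cop : coprime n' p'.
  by rewrite /coprime -(eqn_pmul2r g0) muln_gcdl -En -Ep mul1n.
have -> : (m * p %/ g = m * p')%N by rewrite Ep mulnA mulnK.
have -> : (n * q %/ g = n' * q)%N by rewrite En mulnAC mulnK.
have n'0 : (0 < n')%N by move: n0; rewrite En muln_gt0 => /andP[].
clearbody g; subst n p; split.
  move=> [k [-> ->]]; exists (p' * g * (n' * k))%N.
    by exists (n' * k)%N; split=> //; lia.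
  by exists (p' * k)%N; split; lia.
move=> [z [k [-> ->]] [l [Ekl ->]]].
have {}Ekl : (p' * k = n' * l)%N.
  by apply/eqP; rewrite -(eqn_pmul2r g0) mulnAC Ekl mulnAC.
have /dvdnP[j Ek] : (n' %| k)%N.
  by rewrite -(Gauss_dvdr _ cop) Ekl dvdn_mulr.
exists j; subst k; split; first by lia.
rewrite -mulnA; congr muln; apply/eqP; rewrite -(eqn_pmul2l n'0) -Ekl.
by apply/eqP; lia.
Qed.

Lemma leech_actM : {morph leech_act : u v / leech_mul u v >-> u * v}.
Proof.
move=> [m n] [p q]; apply: pinjP => x y.
rewrite [X in _ <-> X]pinj_mulE [X in X <-> _]leech_act_funE /=.
rewrite (leech_comp _ _ _ _ (valP n) (valP p)).
split=> -[z]; first by move=> xz zy; exists z; apply/leech_act_funE.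
by move=> /leech_act_funE xz /leech_act_funE zy; exists z.
Qed.

Lemma leech_mulA : associative leech_mul.
Proof. by move=> u v w; apply: leech_actI; rewrite !leech_actM mulgA. Qed.

Lemma leech_mul1 : left_id leech_one leech_mul.
Proof. by move=> u; apply: leech_actI; rewrite leech_actM leech_act1 mul1g. Qed.

Lemma leech_invK : involutive leech_inv.
Proof. by case. Qed.

Lemma leech_invM : {morph leech_inv : u v / leech_mul u v >-> leech_mul v u}.
Proof.
by move=> u v; apply: leech_actI; rewrite !(leech_actM, leech_actV) invgM.
Qed.

HB.instance Definition _ := Choice.copy leech (posnat * posnat)%type.
HB.instance Definition _ := isStarMonoid.Build leech
  leech_mulA leech_mul1 leech_invK leech_invM.

Lemma leech_mulgVg u : u * u^-1 * u = u.
Proof. by apply: leech_actI; rewrite !(leech_actM, leech_actV) mulgVg. Qed.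

Lemma leech_mulgV_comm u v :
  (u * u^-1) * (v * v^-1) = (v * v^-1) * (u * u^-1).
Proof. by apply: leech_actI; rewrite !(leech_actM, leech_actV) mulgV_comm. Qed.

HB.instance Definition _ := StarMonoid_isInverseMonoid.Build leech
  leech_mulgVg leech_mulgV_comm.

End Leech.

Inductive iterm (X : Type) : Type :=
| TGen of X
| TOne
| TMul of iterm X & iterm X
| TInv of iterm X.
Arguments TOne {X}.

HB.instance Definition _ X := gen_eqMixin (iterm X).
HB.instance Definition _ X := gen_choiceMixin (iterm X).

Section Presentation.
Variables (X : Type) (rels : iterm X -> iterm X -> Prop).

(* The least congruence on terms that contains [rels] and whose quotient is an
   inverse monoid. *)
Inductive pres_cong : iterm X -> iterm X -> Prop :=
| PC_rel t u : rels t u -> pres_cong t u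
| PC_refl t : pres_cong t t
| PC_sym t u : pres_cong t u -> pres_cong u t
| PC_trans t u v : pres_cong t u -> pres_cong u v -> pres_cong t v
| PC_mul t t' u u' : pres_cong t t' -> pres_cong u u' ->
    pres_cong (TMul t u) (TMul t' u')
| PC_inv t t' : pres_cong t t' -> pres_cong (TInv t) (TInv t')
| PC_mulA t u v : pres_cong (TMul t (TMul u v)) (TMul (TMul t u) v)
| PC_mul1r t : pres_cong (TMul TOne t) t
| PC_mulr1 t : pres_cong (TMul t TOne) t
| PC_invK t : pres_cong (TInv (TInv t)) t
| PC_invM t u : pres_cong (TInv (TMul t u)) (TMul (TInv u) (TInv t))
| PC_mulVg t : pres_cong (TMul (TMul t (TInv t)) t) t
| PC_comm t u :
    pres_cong (TMul (TMul t (TInv t)) (TMul u (TInv u)))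
              (TMul (TMul u (TInv u)) (TMul t (TInv t))).

Definition pres_congb (t u : iterm X) : bool := `[< pres_cong t u >].

Lemma pres_congb_class : equiv_class_of pres_congb.
Proof.
split=> [t|t u|t u v]; rewrite /pres_congb.
- by apply/asboolP; exact: PC_refl.
- by apply/asboolP/asboolP; exact: PC_sym.
- by move=> /asboolP tu /asboolP uv; apply/asboolP; exact: PC_trans tu uv.
Qed.

Canonical pres_equiv := EquivRelPack pres_congb_class.

Definition presented : Type := {eq_quot pres_equiv}%qT.

HB.instance Definition _ := Choice.on presented.
HB.instance Definition _ := Quotient.on presented.

Lemma pres_eqP (t u : iterm X) :
  (\pi_presented t = \pi_presented u)%qT <-> pres_cong t u.
Proof.
by split=> [/eqquotP/asboolP|/asboolP tu]; last apply/eqquotP.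
Qed.

Definition pres_one : presented := (\pi_presented TOne)%qT.
Definition pres_mul (x y : presented) : presented :=
  (\pi_presented (TMul (repr x) (repr y)))%qT.
Definition pres_inv (x : presented) : presented := (\pi_presented (TInv (repr x)))%qT.

Lemma pres_repr t : pres_cong (repr (\pi_presented t)%qT) t.
Proof. by apply/pres_eqP; rewrite reprK. Qed.

Lemma pres_mulE t u : pres_mul (\pi_presented t)%qT (\pi_presented u)%qT = (\pi_presented (TMul t u))%qT.
Proof. by apply/pres_eqP/PC_mul; exact: pres_repr. Qed.

Lemma pres_invE t : pres_inv (\pi_presented t)%qT = (\pi_presented (TInv t))%qT.
Proof. by apply/pres_eqP/PC_inv; exact: pres_repr. Qed.

Lemma pres_mulA : associative pres_mul.
Proof.
elim/quotW=> t; elim/quotW=> u; elim/quotW=> v.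
rewrite (pres_mulE u v) (pres_mulE t u) pres_mulE pres_mulE.
by apply/pres_eqP; exact: PC_mulA.
Qed.

Lemma pres_mul1 : left_id pres_one pres_mul.
Proof. by elim/quotW=> t; rewrite pres_mulE; apply/pres_eqP; exact: PC_mul1r. Qed.

Lemma pres_invK : involutive pres_inv.
Proof.
elim/quotW=> t; rewrite (pres_invE t) pres_invE.
by apply/pres_eqP; exact: PC_invK.
Qed.

Lemma pres_invM : {morph pres_inv : x y / pres_mul x y >-> pres_mul y x}.
Proof.
elim/quotW=> t; elim/quotW=> u.
rewrite (pres_mulE t u) (pres_invE t) (pres_invE u) pres_invE pres_mulE.
by apply/pres_eqP; exact: PC_invM.
Qed.

HB.instance Definition _ := isStarMonoid.Build presented
  pres_mulA pres_mul1 pres_invK pres_invM.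

Lemma pres_mulgVg (x : presented) : x * x^-1 * x = x.
Proof.
elim/quotW: x => t; set x := (\pi t)%qT.
rewrite -[LHS]/(pres_mul (pres_mul x (pres_inv x)) x).
rewrite (pres_invE t) (pres_mulE t) pres_mulE.
by apply/pres_eqP; exact: PC_mulVg.
Qed.

Lemma pres_mulgV_comm (x y : presented) :
  (x * x^-1) * (y * y^-1) = (y * y^-1) * (x * x^-1).
Proof.
elim/quotW: x => t; set x := (\pi t)%qT.
elim/quotW: y => u; set y := (\pi u)%qT.
rewrite -[LHS]/(pres_mul (pres_mul x (pres_inv x)) (pres_mul y (pres_inv y))).
rewrite -[RHS]/(pres_mul (pres_mul y (pres_inv y)) (pres_mul x (pres_inv x))).
rewrite (pres_invE t) (pres_invE u) (pres_mulE t) (pres_mulE u).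
rewrite [LHS]pres_mulE [RHS]pres_mulE.
by apply/pres_eqP; exact: PC_comm.
Qed.

HB.instance Definition _ := StarMonoid_isInverseMonoid.Build presented
  pres_mulgVg pres_mulgV_comm.

End Presentation.

(* A presentation of an inverse monoid with zero: [TGen None] is an additional
   generator for the zero, made absorbing by the first two families of
   relations. *)
Inductive polycyclic_rel (k : nat) :
  iterm (option 'I_k) -> iterm (option 'I_k) -> Prop :=
| PR_zerol t : polycyclic_rel (TMul (TGen None) t) (TGen None)
| PR_zeror t : polycyclic_rel (TMul t (TGen None)) (TGen None)
| PR_gen i j : polycyclic_rel (TMul (TGen (Some i)) (TInv (TGen (Some j))))
                              (if i == j then TOne else TGen None).

Definition polycyclic (k : nat) : inverseMonoidType :=
  presented (@polycyclic_rel k).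

Inductive bicyclic_rel : iterm unit -> iterm unit -> Prop :=
| BR_gen : bicyclic_rel (TMul (TInv (TGen tt)) (TGen tt)) TOne.

Definition bicyclic : inverseMonoidType := presented bicyclic_rel.

(* Main.v *)
Require Import Defs.
From mathcomp Require Import all_boot.
From mathcomp Require Import boolp classical_sets functions cardinality.

Local Open Scope classical_set_scope.
Local Open Scope card_scope.

Import Algebra.

(* Each of the three monoids is compared with its image in the partial
   injections of [nat] through normal forms.  Leech's element [(m, n)] acts as
   [n * k |-> m * k], which is [R_{m,0}^-1 * R_{n,0}].  A nonzero element of the
   polycyclic monoid is [w^-1 * v] for two words [w] and [v]; the inverse of a
   word acts as a strictly increasing affine map, written in base [a] by the
   letters of the word, and a strictly increasing map is determined by its
   range, so that [v] and [w] can be read off from the domain and the range of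
   the action.  For every [a > 1], the element [R_{a,0}^-1] generates a bicyclic
   monoid whose elements act as [a ^ j * n |-> a ^ i * n], and [a] can be
   recovered from the divisibility relations between these numbers.  There are
   only countably many bicyclic copies because each is generated by one
   element of the countable monoid [A]. *)

(** * Generated inverse submonoids and their images under morphisms *)

Section Generation.
Local Open Scope group_scope.

Lemma inverse_monoid_gen_submonoid (M : inverseMonoidType) (G : set M) :
  inverse_submonoid (inverse_monoid_gen G).
Proof.
split; first by move=> A [[]].
split=> [x y Sx Sy A AG|x Sx A AG]; case: (AG) => -[_ [AM AV]] _.
  by apply: AM; [exact: Sx|exact: Sy].
by apply: AV; exact: Sx.
Qed.

Lemma inverse_semigroup_gen_subsemigroup (M : inverseMonoidType) (G : set M) :
  inverse_subsemigroup (inverse_semigroup_gen G).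
Proof.
split=> [x y Sx Sy A AG|x Sx A AG]; case: (AG) => -[AM AV] _.
  by apply: AM; [exact: Sx|exact: Sy].
by apply: AV; exact: Sx.
Qed.

Context {M N : inverseMonoidType}.

Lemma inverse_monoid_gen_ind (G : set M) (P : M -> Prop) :
  inverse_monoid_gen G = setT -> P 1 ->
  (forall x y, P x -> P y -> P (x * y)) -> (forall x, P x -> P x^-1) ->
  (forall x, G x -> P x) -> forall x, P x.
Proof.
move=> GT P1 PM PV PG x; have : [set: M] x by [].
by rewrite -GT => /(_ [set x | P x]); apply.
Qed.

(** Both inclusions follow by minimality: preimages and images of inverse submonoids under [f] are
    again inverse submonoids. *)
Lemma image_inverse_monoid_gen (f : M -> N) (G : set M) :
  monoid_morphism f -> {morph f : x / x^-1} ->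
  f @` inverse_monoid_gen G = inverse_monoid_gen (f @` G).
Proof.
move=> [f1 fM] fV; apply/seteqP; split.
  move=> _ [x Gx <-].
  have [S1 [SM SV]] := inverse_monoid_gen_submonoid N (f @` G).
  apply: (Gx (f @^-1` inverse_monoid_gen (f @` G))); split.
    split; first by rewrite /= f1.
    by split=> [u v /= Su Sv|u /= Su]; rewrite (fM, fV); auto.
  by move=> y Gy; apply: sub_gen_smallest; exists y.
have [S1 [SM SV]] := inverse_monoid_gen_submonoid M G.
apply: smallest_sub; last by apply: image_subset; exact: sub_gen_smallest.
split; first by exists 1.
split=> [_ _ [x Sx <-] [y Sy <-]|_ [x Sx <-]].
  by exists (x * y); [exact: SM|exact: fM].
by exists x^-1; [exact: SV|exact: fV].
Qed.

Lemma isomorphic_copy_gen (f : M -> N) (G : set M) :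
  monoid_morphism f -> {morph f : x / x^-1} -> injective f ->
  inverse_monoid_gen G = setT ->
  isomorphic_copy M (inverse_monoid_gen (f @` G)).
Proof.
move=> fm fV fI GT; exists f; split=> //.
by rewrite -GT; exact: (image_inverse_monoid_gen f).
Qed.

End Generation.

(** * The universal property of a presentation *)

Section Presented.
Context {X : Type} {rels : iterm X -> iterm X -> Prop}.
Local Open Scope group_scope.

Definition pgen (x : X) : presented rels := (\pi_(presented rels) (TGen x))%qT.

Lemma pgen_gen : inverse_monoid_gen (range pgen) = setT.
Proof.
apply/seteqP; split=> // x _.
have [S1 [SM SV]] := inverse_monoid_gen_submonoid (presented rels) (range pgen).
elim/quotW: x => t; elim: t => [x||t IHt u IHu|t IHt].
- by apply: sub_gen_smallest; exists x.
- exact: S1.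
- by rewrite -pres_mulE; exact: SM.
- by rewrite -pres_invE; exact: SV.
Qed.

Context {N : inverseMonoidType}.
Variable g : X -> N.

Fixpoint ieval (t : iterm X) : N :=
  match t with
  | TGen x => g x
  | TOne => 1
  | TMul t u => ieval t * ieval u
  | TInv t => (ieval t)^-1
  end.

(** Evaluates a chosen representative; independence of the choice comes from [g_rels], through
    [ieval_cong]. *)
Definition pres_lift (x : presented rels) : N := ieval (repr x).

Hypothesis g_rels : forall t u, rels t u -> ieval t = ieval u.

(** Apart from [rels], the congruence is built from equivalence and compatibility rules and from
    laws valid in every inverse monoid, hence in [N]. *)
Lemma ieval_cong t u : pres_cong rels t u -> ieval t = ieval u.
Proof.
elim=> {t u} //=.
- by move=> t u v _ -> _ ->.
- by move=> t t' u u' _ -> _ ->.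
- by move=> t t' _ ->.
- by move=> t u v; rewrite mulgA.
- by move=> t; rewrite mul1g.
- by move=> t; rewrite mulg1.
- by move=> t; rewrite invgK.
- by move=> t u; rewrite invgM.
- by move=> t; rewrite mulgVg.
- by move=> t u; rewrite mulgV_comm.
Qed.

Lemma pres_liftE t : pres_lift (\pi t)%qT = ieval t.
Proof. by apply: ieval_cong; exact: pres_repr. Qed.

Lemma pres_lift_morphism : monoid_morphism pres_lift.
Proof.
split; first exact: (pres_liftE TOne).
elim/quotW=> t; elim/quotW=> u.
by rewrite -[_ * _]/(pres_mul _ _) pres_mulE !pres_liftE.
Qed.

Lemma pres_liftV : {morph pres_lift : x / x^-1}.
Proof.
by elim/quotW=> t; rewrite -[_^-1]/(pres_inv _) pres_invE !pres_liftE.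
Qed.

Lemma pres_lift_gen x : pres_lift (pgen x) = g x.
Proof. exact: pres_liftE. Qed.

End Presented.

(** * The graphs of the maps [arith a b] and of their inverses *)

Section Arith.
Local Open Scope group_scope.

Lemma arithE (a b x y : nat) : (0 < a)%N ->
  arith a b x = Some y <-> x = (a * y + b)%N.
Proof.
move=> a0; rewrite /= /arith_fun.
case: asboolP => [[m ->]|nx]; last by split=> // xE; case: nx; exists y.
rewrite addnK mulKn //; split=> [[->]//|/eqP].
by rewrite eqn_add2r eqn_pmul2l // => /eqP ->.
Qed.

Lemma arithVE (a b x y : nat) : (0 < a)%N ->
  (arith a b)^-1 x = Some y <-> y = (a * x + b)%N.
Proof.
by move=> a0; apply: iff_trans (pinj_inv_funE _ _ _) _; exact: arithE.
Qed.

Lemma arith_mulV (a b : nat) : (0 < a)%N -> arith a b * (arith a b)^-1 = 1.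
Proof.
move=> a0; apply: pinjP => x y; rewrite pinj_mulE.
split=> [[z /(arithVE _ _ _ _ a0) -> /(arithE _ _ _ _ a0)]|[<-]].
  by move=> /eqP; rewrite eqn_add2r eqn_pmul2l // => /eqP ->.
by exists (a * x + b)%N; [exact/arithVE|exact/arithE].
Qed.

(** Although generated only as an inverse semigroup, it contains the identity, which is
    [arith 1 0]. *)
Lemma arithmetic_monoid_submonoid : inverse_submonoid arithmetic_monoid.
Proof.
split; last exact: inverse_semigroup_gen_subsemigroup.
apply: sub_gen_smallest; exists 1%N, 0%N; split=> //.
apply: pinjP => x y; rewrite arithE // mul1n addn0.
by split=> [[->]|->].
Qed.

Lemma arithmetic_monoid_arith a b : (b < a)%N -> arithmetic_monoid (arith a b).
Proof. by move=> ba; apply: sub_gen_smallest; exists a, b. Qed.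

End Arith.

(** * The copy of Leech's monoid *)

Section Leech.
Local Open Scope group_scope.

Let posone : posnat := exist _ 1%N isT.

Lemma leech_gen :
  inverse_monoid_gen (range (fun a : posnat => (posone, a) : leech)) = setT.
Proof.
apply/seteqP; split=> // -[m n] _.
have [_ [SM SV]] := inverse_monoid_gen_submonoid leech
  (range (fun a : posnat => (posone, a) : leech)).
(* The product is [(m, 1) * (1, n)], where the gcd to divide by is [gcdn 1 1 = 1]. *)
have -> : (m, n) = ((posone, m) : leech)^-1 * (posone, n).
  by congr pair; apply: val_inj; rewrite /= ?muln1 ?mul1n gcdn1 divn1.
by apply: SM; first apply: SV; apply: sub_gen_smallest; [exists m|exists n].
Qed.

Lemma leech_act_arith (a : posnat) : leech_act (posone, a) = arith (val a) 0.
Proof.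
apply: pinjP => x y; rewrite arithE ?(valP a) // addn0 leech_act_funE /=.
by split=> [[k [-> ->]]|->]; [rewrite mul1n|exists y; rewrite mul1n].
Qed.

Lemma leech_copy : isomorphic_copy leech
  (inverse_monoid_gen [set f | exists a : nat, (0 < a)%N /\ f = arith a 0]).
Proof.
have := isomorphic_copy_gen _ _ (conj leech_act1 leech_actM) leech_actV
  leech_actI leech_gen.
congr (isomorphic_copy _ (inverse_monoid_gen _)); apply/seteqP; split.
  move=> _ [_ [a _ <-] <-]; exists (val a); split; first exact: valP.
  exact: leech_act_arith.
move=> _ [a [a0 ->]]; exists (posone, exist _ a a0); last first.
  exact: leech_act_arith.
by exists (exist _ a a0).
Qed.

End Leech.

(** * Normal forms in the polycyclic monoid *)

Section Polycyclic.
Local Open Scope group_scope.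
Variable k : nat.

Definition pzero : polycyclic k := pgen None.
Definition pletter (i : 'I_k) : polycyclic k := pgen (Some i).

Lemma pzerol (x : polycyclic k) : pzero * x = pzero.
Proof.
elim/quotW: x => t; rewrite -[LHS]/(pres_mul _ _) pres_mulE.
by apply/pres_eqP/PC_rel; exact: PR_zerol.
Qed.

Lemma pzeror (x : polycyclic k) : x * pzero = pzero.
Proof.
elim/quotW: x => t; rewrite -[LHS]/(pres_mul _ _) pres_mulE.
by apply/pres_eqP/PC_rel; exact: PR_zeror.
Qed.

Lemma pzeroV : pzero^-1 = pzero.
(* With [z] the zero, [z^-1 = z^-1 * z * z^-1], which absorption turns into [z]. *)
Proof. by rewrite -[LHS]mulgVg invgK pzeror pzerol. Qed.

Lemma pletter_mulV i j :
  pletter i * (pletter j)^-1 = if i == j then 1 else pzero.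
Proof.
rewrite -[LHS]/(pres_mul (pgen _) (pres_inv (pgen _))) pres_invE pres_mulE.
transitivity (\pi_(polycyclic k) (if i == j then TOne else TGen None))%qT.
  by apply/pres_eqP/PC_rel; exact: PR_gen.
by case: ifP.
Qed.

(* The letters are multiplied from right to left, so that the inverse of
   [pword v] acts as [base_expand v] in the representation on [nat]. *)
Fixpoint pword (v : seq 'I_k) : polycyclic k :=
  if v is i :: v' then pword v' * pletter i else 1.

Lemma pword_cat u v : pword (u ++ v) = pword v * pword u.
Proof. by elim: u => [|i u IH] /=; rewrite ?mulg1 // IH mulgA. Qed.

(** The heads of the two words meet in the middle of the product: equal letters cancel and distinct
    ones give zero, until one of the words is exhausted. *)
Lemma pword_mulV v w :
  [\/ pword v * (pword w)^-1 = pzero,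
      exists u, pword v * (pword w)^-1 = pword u |
      exists u, pword v * (pword w)^-1 = (pword u)^-1].
Proof.
elim: v w => [|i v IH] [|j w] /=.
- by apply: Or32; exists [::]; rewrite /= invg1 mulg1.
- by apply: Or33; exists (j :: w); rewrite mul1g.
- by apply: Or32; exists (i :: v); rewrite /= invg1 mulg1.
rewrite invgM mulgA -(mulgA (pword v)) pletter_mulV.
by case: ifP => _; rewrite ?mulg1 // pzeror pzerol; apply: Or31.
Qed.

Definition polycyclic_normal (x : polycyclic k) : Prop :=
  x = pzero \/ exists w v, x = (pword w)^-1 * pword v.

Lemma polycyclic_nfM x y :
  polycyclic_normal x -> polycyclic_normal y -> polycyclic_normal (x * y).
Proof.
case=> [->|[w [v ->]]]; first by left; exact: pzerol.
case=> [->|[w' [v' ->]]]; first by left; exact: pzeror.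
rewrite mulgA -(mulgA (pword w)^-1).
case: (pword_mulV v w') => [->|[u ->]|[u ->]].
- by left; rewrite pzeror pzerol.
- by right; exists w, (v' ++ u); rewrite pword_cat mulgA.
- by right; exists (w ++ u), v'; rewrite pword_cat invgM.
Qed.

Lemma polycyclic_nf x : polycyclic_normal x.
Proof.
move: x; apply: (inverse_monoid_gen_ind _ _ pgen_gen) => [|y z|y|].
- by right; exists [::], [::]; rewrite /= invg1 mulg1.
- exact: polycyclic_nfM.
- case=> [->|[w [v ->]]]; [left; exact: pzeroV|right].
  by exists v, w; rewrite invgM invgK.
- move=> _ [[i|] _ <-]; [right|by left].
  by exists [::], [:: i]; rewrite /= invg1 !mul1g.
Qed.

Lemma pletter_gen : (1 < k)%N -> inverse_monoid_gen (range pletter) = setT.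
Proof.
move=> k1; apply/seteqP; split=> // x _.
have [S1 [SM SV]] := inverse_monoid_gen_submonoid (polycyclic k) (range pletter).
move: x; apply: (inverse_monoid_gen_ind _ _ pgen_gen) => // _ [[i|] _ <-].
  by apply: sub_gen_smallest; exists i.
(* Two distinct letters, available since [1 < k], produce the zero. *)
have -> : pgen None =
    pletter (Ordinal (ltnW k1)) * (pletter (Ordinal k1))^-1.
  by rewrite pletter_mulV.
by apply: SM; [|apply: SV]; apply: sub_gen_smallest; eexists.
Qed.

End Polycyclic.

(** * Strictly increasing maps compared through their ranges *)

Lemma homo_ltn_range_le (f g : nat -> nat) :
  {homo f : i j / (i < j)%N} -> {homo g : i j / (i < j)%N} ->
  (forall n, exists m, f n = g m) -> forall n, (g n <= f n)%N.
Proof.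
move=> fh gh fg.
suff le n m : f n = g m -> (n <= m)%N.
  by move=> n; have [m E] := fg n; rewrite E (leq_mono gh); exact: le.
elim: n m => // n IH m E; have [m' E'] := fg n.
by apply: (leq_ltn_trans (IH _ E')); rewrite -(leqW_mono (leq_mono gh)) -E' -E fh.
Qed.

Lemma homo_ltn_range_inj (f g : nat -> nat) :
  {homo f : i j / (i < j)%N} -> {homo g : i j / (i < j)%N} ->
  range f = range g -> f =1 g.
Proof.
move=> fh gh E n; apply/eqP; rewrite eqn_leq.
apply/andP; split; apply: homo_ltn_range_le => // m.
  have : range f (g m) by rewrite E; exists m.
  by case=> m' _ <-; exists m'.
have : range g (f m) by rewrite -E; exists m.
by case=> m' _ <-; exists m'.
Qed.

(** * The faithful action of the polycyclic monoid on [nat] *)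

Section PolycyclicArith.
Local Open Scope group_scope.
Variable a : nat.
Hypothesis a1 : (1 < a)%N.

Let a0 : (0 < a)%N. Proof. exact: ltnW. Qed.

Lemma pinj_empty_inj : partial_injective (fun _ : nat => @None nat).
Proof. by []. Qed.

Definition pinj_empty : pinj nat := PInj pinj_empty_inj.

Definition arith_letter (o : option 'I_a) : pinj nat :=
  if o is Some i then arith a i else pinj_empty.

Lemma arith_letter_rels t u :
  polycyclic_rel t u -> ieval arith_letter t = ieval arith_letter u.
Proof.
case=> {t u} [t|t|i j] /=.
- by apply: pinjP => x y; rewrite pinj_mulE; split=> // -[].
- by apply: pinjP => x y; rewrite pinj_mulE; split=> // -[].
case: eqP => [->|ij] /=; first exact: arith_mulV.
apply: pinjP => x y; rewrite pinj_mulE; split=> //.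
(* A point in the domain would lead to a number congruent to both [i] and [j] modulo [a], so
   distinct letters compose to the empty map. *)
case=> z /(arithVE _ _ _ _ a0) -> /(arithE _ _ _ _ a0) /(congr1 (modn^~ a)).
by rewrite ![(a * _)%N]mulnC !modnMDl !modn_small // => /esym/val_inj.
Qed.

Definition polycyclic_act : polycyclic a -> pinj nat := pres_lift arith_letter.

Let act_morph : monoid_morphism polycyclic_act.
Proof. exact: (pres_lift_morphism _ arith_letter_rels). Qed.

Let actV : {morph polycyclic_act : x / x^-1}.
Proof. exact: (pres_liftV _ arith_letter_rels). Qed.

Lemma polycyclic_act_letter i : polycyclic_act (pletter _ i) = arith a i.
Proof. exact: (pres_lift_gen _ arith_letter_rels (Some i)). Qed.

Lemma polycyclic_act_zero : polycyclic_act (pzero _) = pinj_empty.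
Proof. exact: (pres_lift_gen _ arith_letter_rels None). Qed.

Fixpoint base_expand (v : seq 'I_a) (n : nat) : nat :=
  if v is i :: v' then (a * base_expand v' n + i)%N else n.

Lemma base_expand_homo v : {homo base_expand v : i j / (i < j)%N}.
Proof.
move=> i j ij; elim: v => //= x v IH.
by rewrite ltn_add2r ltn_pmul2l.
Qed.

(** The head letter is the residue modulo [a]; cancelling it leaves the same equation for the
    tails. *)
Lemma base_expand_inj v w : base_expand v =1 base_expand w -> v = w.
Proof.
(* The value at 0 forces [i = 0]; the value at 1 then makes [a] a divisor of 1. *)
have nil_cons i u : ~ (forall n, n = base_expand (i :: u) n).
  move=> E; have /= /esym/eqP := E 0%N; have /= E1 := E 1%N.
  rewrite addn_eq0 => /andP[_ /eqP i0]; move: E1.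
  rewrite i0 addn0 => /esym/eqP; rewrite muln_eq1 => /andP[/eqP aE _].
  by move: a1; rewrite aE.
elim: v w => [|i v IH] [|j w] E //; first by case: (nil_cons j w).
  by case: (nil_cons i v) => n; rewrite E.
have Eij : i = j.
  apply: val_inj; have /= := congr1 (modn^~ a) (E 0%N).
  by rewrite ![(a * _)%N]mulnC !modnMDl !modn_small.
rewrite Eij; congr cons; apply: IH => n; have /= /eqP := E n.
by rewrite Eij eqn_add2r eqn_pmul2l // => /eqP.
Qed.

Lemma polycyclic_act_word v x y :
  polycyclic_act (pword _ v) x = Some y <-> x = base_expand v y.
Proof.
have [act1 actM] := act_morph.
elim: v x y => [|i v IH] x y; first by rewrite act1 /=; split=> [[]|->].
rewrite /= actM pinj_mulE polycyclic_act_letter; split.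
  by case=> z /(arithE _ _ _ _ a0) -> /IH ->.
by move=> ->; exists (base_expand v y); [exact/arithE|exact/IH].
Qed.

Lemma polycyclic_act_nf w v x y :
  polycyclic_act ((pword _ w)^-1 * pword _ v) x = Some y <->
  exists n, x = base_expand v n /\ y = base_expand w n.
Proof.
have [_ actM] := act_morph; rewrite actM actV pinj_mulE.
split=> [[n /polycyclic_act_word xE /pinj_inv_funE]|[n [xE yE]]].
  by move=> /polycyclic_act_word yE; exists n.
exists n; first exact/polycyclic_act_word.
by apply/pinj_inv_funE/polycyclic_act_word.
Qed.

(** The action is defined at [base_expand v 0]. *)
Lemma polycyclic_act_nf_neq0 w v :
  polycyclic_act ((pword _ w)^-1 * pword _ v) <> pinj_empty.
Proof.
move=> E; have : polycyclic_act ((pword _ w)^-1 * pword _ v)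
    (base_expand v 0) = Some (base_expand w 0).
  by apply/polycyclic_act_nf; exists 0%N.
by rewrite E.
Qed.

Lemma polycyclic_act_nf_inj w v w' v' :
  polycyclic_act ((pword _ w)^-1 * pword _ v) =
    polycyclic_act ((pword _ w')^-1 * pword _ v') -> w = w' /\ v = v'.
Proof.
(* The domain of the action is the range of [base_expand z], which determines [z]; applied to the
   inverses, the same argument recovers the other word. *)
suff dom u z u' z' : polycyclic_act ((pword _ u)^-1 * pword _ z) =
    polycyclic_act ((pword _ u')^-1 * pword _ z') -> z = z'.
  move=> E; split; last exact: (dom _ _ _ _ E).
  apply: (dom v _ v'); move: (congr1 (fun f => f^-1) E).
  by rewrite -!actV !invgM !invgK.
move=> E; apply/base_expand_inj/homo_ltn_range_inj; try exact: base_expand_homo.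
apply/seteqP; split=> _ [n _ <-].
  have /polycyclic_act_nf : polycyclic_act ((pword _ u')^-1 * pword _ z')
      (base_expand z n) = Some (base_expand u n).
    by rewrite -E; apply/polycyclic_act_nf; exists n.
  by case=> m [-> _]; exists m.
have /polycyclic_act_nf : polycyclic_act ((pword _ u)^-1 * pword _ z)
    (base_expand z' n) = Some (base_expand u' n).
  by rewrite E; apply/polycyclic_act_nf; exists n.
by case=> m [-> _]; exists m.
Qed.

Lemma polycyclic_act_inj : injective polycyclic_act.
Proof.
move=> x y; case: (polycyclic_nf _ x) => [->|[w [v ->]]];
  case: (polycyclic_nf _ y) => [->|[w' [v' ->]]] //.
- by rewrite polycyclic_act_zero => /esym/polycyclic_act_nf_neq0.
- by rewrite polycyclic_act_zero => /polycyclic_act_nf_neq0.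
- by move=> /polycyclic_act_nf_inj[-> ->].
Qed.

Lemma polycyclic_copy : isomorphic_copy (polycyclic a)
  (inverse_monoid_gen [set f | exists b : nat, (b < a)%N /\ f = arith a b]).
Proof.
have := isomorphic_copy_gen _ _ act_morph actV polycyclic_act_inj
  (pletter_gen _ a1).
congr (isomorphic_copy _ (inverse_monoid_gen _)); apply/seteqP; split.
  by move=> _ [_ [i _ <-] <-]; exists i; rewrite polycyclic_act_letter.
move=> _ [b [ba ->]]; exists (pletter _ (Ordinal ba)); first by eexists.
exact: polycyclic_act_letter.
Qed.

End PolycyclicArith.

(** * Normal forms and faithful actions of the bicyclic monoid *)

Section Bicyclic.
Local Open Scope group_scope.

Definition bgen : bicyclic := pgen tt.

Lemma bgenVM : bgen^-1 * bgen = 1.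
Proof.
rewrite -[LHS]/(pres_mul (pres_inv (pgen _)) (pgen _)) pres_invE pres_mulE.
apply/pres_eqP; apply: PC_rel; exact: BR_gen.
Qed.

Lemma bgen_gen : inverse_monoid_gen [set bgen] = setT.
Proof.
rewrite -(@pgen_gen unit bicyclic_rel); congr inverse_monoid_gen.
by apply/seteqP; split=> [_ ->|_ [[] _ <-]] //; exists tt.
Qed.

Lemma bgenXVX j i : (j <= i)%N -> (bgen ^+ j)^-1 * bgen ^+ i = bgen ^+ (i - j).
Proof.
elim: j i => [|j IH] i; first by rewrite expg0 invg1 mul1g subn0.
case: i => // i ji; rewrite !expgS invgM mulgA -(mulgA _ bgen^-1) bgenVM mulg1.
by rewrite subSS IH.
Qed.

Lemma bgen_nfM i j k l : exists m n,
  bgen ^+ i * (bgen ^+ j)^-1 * (bgen ^+ k * (bgen ^+ l)^-1) =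
    bgen ^+ m * (bgen ^+ n)^-1.
Proof.
rewrite mulgA -(mulgA (bgen ^+ i)); case: (leqP j k) => jk.
  by rewrite bgenXVX // -expgnDr; exists (i + (k - j))%N, l.
(* Here [k < j], and the middle factor is the inverse of the product computed by [bgenXVX]. *)
exists i, (l + (j - k))%N; rewrite expgnDr invgM [RHS]mulgA.
by rewrite -(bgenXVX _ _ (ltnW jk)) invgM invgK.
Qed.

Lemma bicyclic_nf (x : bicyclic) : exists i j, x = bgen ^+ i * (bgen ^+ j)^-1.
Proof.
move: x; apply: (inverse_monoid_gen_ind _ _ bgen_gen).
- by exists 0%N, 0%N; rewrite expg0 invg1 mulg1.
- move=> _ _ [i [j ->]] [k [l ->]]; exact: bgen_nfM.
- by move=> _ [i [j ->]]; exists j, i; rewrite invgM invgK.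
- by move=> _ ->; exists 1%N, 0%N; rewrite expg1 expg0 invg1 mulg1.
Qed.

Variable a : nat.
Hypothesis a1 : (1 < a)%N.

Let a0 : (0 < a)%N. Proof. exact: ltnW. Qed.

(** The total map [x |-> a * x]; being total, it satisfies the bicyclic relation [s^-1 * s = 1]. *)
Definition multiplication : pinj nat := (arith a 0)^-1.

Lemma multiplicationX i x y :
  (multiplication ^+ i) x = Some y <-> y = (a ^ i * x)%N.
Proof.
elim: i y => [|i IH] y; first by rewrite mul1n /=; split=> [[->]|->].
rewrite expgS pinj_mulE expnS -mulnA; split.
  by case=> z /IH -> /(arithVE _ _ _ _ a0) ->; rewrite addn0.
by move=> ->; exists (a ^ i * x)%N; [exact/IH|apply/arithVE; rewrite ?addn0].
Qed.

Lemma multiplication_rels t u : bicyclic_rel t u ->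
  ieval (fun=> multiplication) t = ieval (fun=> multiplication) u.
Proof. by case; rewrite /= invgK; exact: arith_mulV. Qed.

Definition bicyclic_act : bicyclic -> pinj nat :=
  pres_lift (fun=> multiplication).

Let act_morph : monoid_morphism bicyclic_act.
Proof. exact: (pres_lift_morphism _ multiplication_rels). Qed.

Let actV : {morph bicyclic_act : x / x^-1}.
Proof. exact: (pres_liftV _ multiplication_rels). Qed.

Lemma bicyclic_act_gen : bicyclic_act bgen = multiplication.
Proof. exact: (pres_lift_gen _ multiplication_rels). Qed.

Lemma bicyclic_act_nf i j x y :
  bicyclic_act (bgen ^+ i * (bgen ^+ j)^-1) x = Some y <->
  exists n, x = (a ^ j * n)%N /\ y = (a ^ i * n)%N.
Proof.
have [act1 actM] := act_morph.
have actX n : bicyclic_act (bgen ^+ n) = multiplication ^+ n.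
  elim: n => [|n IH]; first exact: act1.
  by rewrite !expgS actM IH bicyclic_act_gen.
rewrite actM actV !actX pinj_mulE.
split=> [[n /pinj_inv_funE /multiplicationX -> /multiplicationX ->]|].
  by exists n.
case=> n [-> ->]; exists n; last exact/multiplicationX.
by apply/pinj_inv_funE/multiplicationX.
Qed.

(** If two normal forms act alike, the pair [a ^ j1 |-> a ^ i1] of the first lies in the graph of
    the second, so its entries are multiples of [a ^ l1] and [a ^ k1]. By symmetry these powers
    agree, and so do the exponents, since [1 < a]. *)
Lemma bicyclic_act_inj : injective bicyclic_act.
Proof.
move=> x y; have [i [j ->]] := bicyclic_nf x; have [k [l ->]] := bicyclic_nf y.
suff dvd i1 j1 k1 l1 : bicyclic_act (bgen ^+ i1 * (bgen ^+ j1)^-1) =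
    bicyclic_act (bgen ^+ k1 * (bgen ^+ l1)^-1) ->
    (a ^ k1 %| a ^ i1)%N /\ (a ^ l1 %| a ^ j1)%N.
  move=> E; have [ki lj] := dvd _ _ _ _ E.
  have [ik jl] := dvd _ _ _ _ (esym E).
  have /(expnI a1) -> : (a ^ i = a ^ k)%N.
    by apply/eqP; rewrite eqn_dvd ik.
  suff /(expnI a1) -> : (a ^ j = a ^ l)%N by [].
  by apply/eqP; rewrite eqn_dvd jl.
move=> E.
have /bicyclic_act_nf : bicyclic_act (bgen ^+ k1 * (bgen ^+ l1)^-1) (a ^ j1)%N
    = Some (a ^ i1)%N.
  by rewrite -E; apply/bicyclic_act_nf; exists 1%N; rewrite !muln1.
by case=> n [-> ->]; rewrite !dvdn_mulr.
Qed.

Definition bicyclic_image : set (pinj nat) :=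
  inverse_monoid_gen [set multiplication].

Lemma bicyclic_imageE : bicyclic_image = range bicyclic_act.
Proof.
rewrite -bgen_gen (image_inverse_monoid_gen _ _ act_morph actV).
by rewrite image_set1 bicyclic_act_gen.
Qed.

Lemma bicyclic_image_copy : isomorphic_copy bicyclic bicyclic_image.
Proof.
by exists bicyclic_act; split=> //;
  [exact: bicyclic_act_inj|rewrite bicyclic_imageE].
Qed.

Lemma bicyclic_image_sub : bicyclic_image `<=` arithmetic_monoid.
Proof.
apply: smallest_sub; first exact: arithmetic_monoid_submonoid.
move=> _ ->; have [_ [_ AV]] := arithmetic_monoid_submonoid.
by apply: AV; exact: arithmetic_monoid_arith.
Qed.

(** The map [arith b 0] sends [b] to 1. In an element acting as [a ^ j * n |-> a ^ i * n], the value
    1 forces [n = 1], whence [b = a ^ j]. *)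
Lemma bicyclic_image_expn b :
  (1 < b)%N -> bicyclic_image (arith b 0) -> exists j, b = (a ^ j)%N.
Proof.
move=> b1; rewrite bicyclic_imageE => -[x _]; have [i [j ->]] := bicyclic_nf x.
move=> E; exists j; have /bicyclic_act_nf[n [bE /esym/eqP]] :
    bicyclic_act (bgen ^+ i * (bgen ^+ j)^-1) b = Some 1%N.
  by rewrite E; apply/arithE; [exact: ltnW|rewrite muln1 addn0].
by rewrite muln_eq1 => /andP[_ /eqP n1]; rewrite bE n1 muln1.
Qed.

End Bicyclic.

(** * Counting the copies of the bicyclic monoid *)

Lemma bicyclic_image_inj :
  injective (fun n : nat => bicyclic_image n.+2).
Proof.
suff le a b : bicyclic_image a.+2 = bicyclic_image b.+2 -> (a <= b)%N.
  by move=> a b E; apply/eqP; rewrite eqn_leq !le.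
move=> E; have [|j bE] := bicyclic_image_expn a.+2 isT b.+2 isT.
  rewrite E -[arith _ _]invgK.
  have [_ [_ SV]] := inverse_monoid_gen_submonoid _ [set multiplication b.+2].
  by apply: SV; exact: sub_gen_smallest.
suff : (a.+2 <= b.+2)%N by [].
(* The exponent [j] is positive because [b.+2] is not 1. *)
by rewrite bE; case: j bE => // j _; rewrite expnS leq_pmulr ?expn_gt0.
Qed.

(** The image of [bgen] generates the copy. *)
Lemma bicyclic_copy_gen (S : set (pinj nat)) : isomorphic_copy bicyclic S ->
  exists2 f, S f & S = inverse_monoid_gen [set f].
Proof.
case=> f [fm fV _ <-]; exists (f bgen); first by exists bgen.
by rewrite -image_set1 -image_inverse_monoid_gen // bgen_gen.
Qed.

(** All nodes carry the label 0: the number of children, 0, 2 or 1, already tells the constructors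
    apart. *)
Fixpoint iterm_code {X} (t : iterm X) : GenTree.tree X :=
  match t with
  | TGen x => GenTree.Leaf x
  | TOne => GenTree.Node 0 [::]
  | TMul t u => GenTree.Node 0 [:: iterm_code t; iterm_code u]
  | TInv t => GenTree.Node 0 [:: iterm_code t]
  end.

Lemma iterm_code_inj X : injective (@iterm_code X).
Proof.
elim=> [x||t IHt u IHu|t IHt] [y||t' u'|t'] //= [].
- by move=> ->.
- by move=> /IHt -> /IHu ->.
- by move=> /IHt ->.
Qed.

Lemma iterm_countable (X : countType) : countable [set: iterm X].
Proof.
apply/countable_injP; exists (pickle \o iterm_code) => t u _ _.
by move=> /(pcan_inj pickleK)/iterm_code_inj.
Qed.

(** Every element is the value of a term over pairs [(a, b)], and such terms are countable. *)
Lemma arithmetic_monoid_countable : countable arithmetic_monoid.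
Proof.
pose ev := ieval (fun ab : nat * nat => arith ab.1 ab.2).
apply: (@sub_countable _ _ _ (range ev)); last first.
  by apply: sub_countable (card_image_le _ _) _; exact: iterm_countable.
apply: subset_card_le; apply: smallest_sub; last first.
  by move=> _ [a [b [_ ->]]]; exists (TGen (a, b)).
split=> [_ _ [t _ <-] [u _ <-]|_ [t _ <-]].
  by exists (TMul t u).
by exists (TInv t).
Qed.

(** Each copy is determined by a generator in the countable set [arithmetic_monoid], which bounds
    their number above. The distinct sets [bicyclic_image n.+2], shifted by 2 so that the multiplier
    exceeds 1, bound it below. *)
Lemma bicyclic_copies_countable :
  [set S : set (pinj nat) |
     S `<=` arithmetic_monoid /\ isomorphic_copy bicyclic S] #= [set: nat].
Proof.
rewrite card_eq_le; apply/andP; split.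
  apply: (@sub_countable _ _ _
    ((fun f : pinj nat => inverse_monoid_gen [set f]) @` arithmetic_monoid)).
    apply: subset_card_le => S [SA /bicyclic_copy_gen[f Sf ->]].
    by exists f => //; exact: SA.
  by apply: sub_countable (card_image_le _ _) _;
    exact: arithmetic_monoid_countable.
apply: (@card_le_trans _ _ _ (range (fun n : nat => bicyclic_image n.+2))).
  have := @inj_card_eq _ _ [set: nat] _ (in2W bicyclic_image_inj).
  by rewrite card_eq_le => /andP[].
by apply: subset_card_le => _ [n _ <-]; split;
  [exact: bicyclic_image_sub|exact: bicyclic_image_copy].
Qed.

Theorem theorem21 :
  [/\
    inverse_monoid_gen [set f | exists a : nat, (0 < a)%N /\ f = arith a 0]
      `<=` arithmetic_monoid /\
    isomorphic_copy leech
      (inverse_monoid_gen [set f | exists a : nat, (0 < a)%N /\ f = arith a 0]),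
    forall a : nat, (1 < a)%N ->
      inverse_monoid_gen [set f | exists b : nat, (b < a)%N /\ f = arith a b]
        `<=` arithmetic_monoid /\
      isomorphic_copy (polycyclic a)
        (inverse_monoid_gen
           [set f | exists b : nat, (b < a)%N /\ f = arith a b])
  & [set S : set (pinj nat) |
       S `<=` arithmetic_monoid /\ isomorphic_copy bicyclic S] #= [set: nat] ].
Proof.
split=> [|a a1|]; last exact: bicyclic_copies_countable.
  split; last exact: leech_copy.
  apply: smallest_sub; first exact: arithmetic_monoid_submonoid.
  by move=> _ [a [a0 ->]]; exact: arithmetic_monoid_arith.
split; last exact: polycyclic_copy.
apply: smallest_sub; first exact: arithmetic_monoid_submonoid.
by move=> _ [b [ba ->]]; exact: arithmetic_monoid_arith.
Qed.
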